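(* Let $K\subset\mathbb{R}^n$ be a finite set of distinct points with $\dim(\mathrm{co}[K])=n$, and let $f_K:K\to\mathbb{R}$ be a function with Lipschitz constant $L>0$ and bound $A_0>0$, that is, $|f_K(x)|\le A_0$ for $x\in K$. Suppose $S=\{x_1,\ldots,x_{n+1}\}\subset K$ is such that $\mathrm{co}[S]$ is a regular Delaunay cell with associated Delaunay ball $B(x_s;r_s)$, and $K\setminus S\neq\varnothing$. Let $\ell_s:\mathbb{R}^n\to\mathbb{R}$ be the affine function with $\ell_s(x)=f_K(x)$ for $x\in S$, let $C_s>0$ be a constant such that $|D\ell_s|\le C_sL$, and let $$\sigma_s=\min\{|x-x_s|-r_s:\ x\in K\setminus S\}>0 .$$ Then, for every $x\in\mathrm{co}[S]$, $$C^u_\lambda(f^{-M}_K)(x)=\lambda|x-x_s|^2-\lambda r_s^2+\ell_s(x),\qquad C^l_\lambda(f^{M}_K)(x)=\lambda r_s^2-\lambda|x-x_s|^2+\ell_s(x),$$ $$A^M_\lambda(f_K)(x)=\frac{C^u_\lambda(f^{-M}_K)(x)+C^l_\lambda(f^{M}_K)(x)}{2}=\ell_s(x),$$ whenever $$\lambda>\frac{2A_0}{\sigma_s(2r_s+\sigma_s)}+\frac{C_sL}{\sigma_s}\qquad\text{and}\qquad M>\lambda r_s^2+C_sLr_s+A_0+\frac{C_s^2L^2}{4\lambda}.$$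
   Context: $\mathrm{co}[E]$ is the convex hull of a set $E$; $\mathrm{co}[g]$ is the convex envelope of a function $g:\mathbb{R}^n\to\mathbb{R}$ bounded below. For bounded $g$ and $\lambda>0$, $$C^l_\lambda(g)(x)=\mathrm{co}[\lambda|\cdot|^2+g](x)-\lambda|x|^2,\qquad C^u_\lambda(g)(x)=\lambda|x|^2-\mathrm{co}[\lambda|\cdot|^2-g](x).$$ For $M>0$, $f_K^{\pm M}$ equals $f_K$ on $K$ and $\pm M$ on $\mathbb{R}^n\setminus K$, and $A^M_\lambda(f_K)=\tfrac12\bigl(C^l_\lambda(f_K^M)+C^u_\lambda(f_K^{-M})\bigr)$. Delaunay cells: for a finite set $K\subset\mathbb{R}^n$, a subset $S\subset K$ generates a Delaunay cell $\mathrm{co}[S]$ with associated open Delaunay ball $B(x_s;r_s)$ (centre $x_s\in\mathbb{R}^n$, radius $r_s>0$) if $B(x_s;r_s)\cap K=\varnothing$, $S=K\cap\partial B(x_s;r_s)$ and $\dim(\mathrm{co}[S])=n$. The cell is regular if $\mathrm{co}[S]$ is an $n$-dimensional simplex, i.e. $\#(S)=n+1$. $D\ell_s$ denotes the (constant) gradient of the affine function $\ell_s$. *)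

(* Defs.v *)
From HB Require Import structures.
From mathcomp Require Import all_boot all_order all_algebra.
From mathcomp Require Import all_classical all_reals all_analysis.

Set Implicit Arguments.
Unset Strict Implicit.
Unset Printing Implicit Defensive.

Import Order.TTheory GRing.Theory Num.Theory.
Import numFieldNormedType.Exports.

Local Open Scope classical_set_scope.
Local Open Scope ring_scope.

Section Euclidean.
Context {R : realType} {n : nat}.
Implicit Types (x c : 'rV[R]_n) (r : R) (E : set 'rV[R]_n).

(* The norm [`|x|] of the library on ['rV_n] is the sup norm, hence this one.
   Likewise [ball] and [k.-lipschitz_A f] of the library refer to the sup
   norm. *)
Definition enorm x : R := Num.sqrt (\sum_(i < n) x 0 i ^+ 2).

Definition eball c r : set 'rV[R]_n := [set x | enorm (x - c) < r].

Definition esphere c r : set 'rV[R]_n := [set x | enorm (x - c) = r].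

Definition elipschitz_on E (f : 'rV[R]_n -> R) (L : R) : Prop :=
  forall x y, E x -> E y -> `|f x - f y| <= L * enorm (x - y).

Definition convex_hull E : set 'rV[R]_n :=
  smallest (fun C : set 'rV[R]_n => convex_set C) E.

(* The dimension of a nonempty set is that of its affine hull; the vector space
   [V] below is the direction of the affine hull, i.e. the smallest linear
   subspace containing all differences of points of [E]. *)
Definition has_dim E (d : nat) : Prop :=
  E !=set0 /\
  exists V : {vspace 'rV[R]_n},
    [/\ forall x y, E x -> E y -> x - y \in V,
        forall W : {vspace 'rV[R]_n},
          (forall x y, E x -> E y -> x - y \in W) -> (V <= W)%VS
      & \dim V = d].

Definition affine_function (f : 'rV[R]_n -> R) : Prop :=
  exists (a : {linear 'rV[R]_n -> R^o}) (b : R), forall x, f x = a x + b.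

Definition gradient (f : 'rV[R]_n -> R) x : 'rV[R]_n :=
  \row_(i < n) ('D_(delta_mx 0 i) (f : 'rV[R]_n -> R^o) x : R).

(* Largest convex function below [g]; the supremum is that of a nonempty bounded
   set of reals as soon as [g] is bounded below. *)
Definition convex_envelope (g : 'rV[R]_n -> R) x : R :=
  sup [set h x | h in [set h : 'rV[R]_n -> R |
    convex_function [set: 'rV[R]_n] h /\ forall y, h y <= g y]].

Definition lower_transform (lambda : R) (g : 'rV[R]_n -> R) x : R :=
  convex_envelope (fun y => lambda * enorm y ^+ 2 + g y) x
  - lambda * enorm x ^+ 2.

Definition upper_transform (lambda : R) (g : 'rV[R]_n -> R) x : R :=
  lambda * enorm x ^+ 2
  - convex_envelope (fun y => lambda * enorm y ^+ 2 - g y) x.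

(* A function on [K] is represented by a total function, of which only the
   values on [K] are used. *)
Definition extend_by (K : set 'rV[R]_n) (f : 'rV[R]_n -> R) (M : R) :
  'rV[R]_n -> R := patch (fun=> M) K f.

Definition average_approx (K : set 'rV[R]_n) (f : 'rV[R]_n -> R)
    (lambda M : R) x : R :=
  2^-1 * (lower_transform lambda (extend_by K f M) x
          + upper_transform lambda (extend_by K f (- M)) x).

Definition delaunay_cell (K S : set 'rV[R]_n) c r : Prop :=
  [/\ 0 < r, S `<=` K, eball c r `&` K = set0, S = K `&` esphere c r
    & has_dim (convex_hull S) n].

Definition regular_delaunay_cell (K S : set 'rV[R]_n) c r : Prop :=
  delaunay_cell K S c r /\ (S #= `I_n.+1)%card.

End Euclidean.

Definition is_min {R : realType} (A : set R) (m : R) : Prop :=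
  A m /\ lbound A m.

(* Main.v *)
Require Import Defs.
From HB Require Import structures.
From mathcomp Require Import all_boot all_order all_algebra.
From mathcomp Require Import all_classical all_reals all_analysis.
From mathcomp Require Import ring lra.

Set Implicit Arguments.
Unset Strict Implicit.
Unset Printing Implicit Defensive.

Import Order.TTheory GRing.Theory Num.Theory.
Import numFieldNormedType.Exports.

Local Open Scope classical_set_scope.
Local Open Scope ring_scope.

(** Why the theorem holds.  Adding [lambda |y|^2] to the candidate value
    [lambda r^2 - lambda |y - c|^2 + l y] of the lower transform on the cell
    ([c], [r] the centre and radius of the Delaunay ball, [l] the interpolating
    affine function) gives a function [p] in which the quadratic terms cancel:
    [p] is affine.  It agrees with [g y = lambda |y|^2 + f^M y] on the vertices
    of the cell, because these lie on the sphere [|y - c| = r].  If moreover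
    [p <= g] everywhere, then [p] is a convex minorant of [g], and every convex
    minorant is below [p] at the vertices, hence on their convex hull; so the
    convex envelope of [g] is [p] on the cell ([convex_envelope_touching]).

    The two thresholds ensure [p <= g].  Write
    [d = |y - c|] and let [D] bound the slope of [l], so that
    [l y <= A0 + D r + D d].  At a point of [K] that is not a vertex,
    [d >= r + sigma], and the needed inequality
    [2 A0 + D (d + r) <= lambda (d - r) (d + r)] splits into one inequality for
    each summand of the lower bound on [lambda].  Off [K], the maximum of
    [D d - lambda d^2] over [d] is [D^2 / (4 lambda)], the last summand of the
    lower bound on [M].  This is [lower_transform_delaunay_cell].

    The upper transform is minus the lower transform of [- f]
    ([upper_transformE]), and the hypotheses are invariant under
    [(f, l) |-> (- f, - l)], so its formula follows; in the average the
    quadratic terms cancel and [l] remains. *)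

Section EuclideanGeometry.
Context {R : realType} {n : nat}.
Implicit Types (x y u v : 'rV[R]_n).

Definition edot u v : R := \sum_(i < n) u 0 i * v 0 i.

Lemma enorm_ge0 x : 0 <= enorm x.
Proof. exact: sqrtr_ge0. Qed.

Lemma sqr_enorm x : enorm x ^+ 2 = edot x x.
Proof.
rewrite sqr_sqrtr; last by apply: sumr_ge0 => i _; exact: sqr_ge0.
by apply: eq_bigr => i _; rewrite expr2.
Qed.

Lemma edotC u v : edot u v = edot v u.
Proof. by apply: eq_bigr => i _; rewrite mulrC. Qed.

Lemma edot_is_linear u : linear (edot u : 'rV[R]_n -> R^o).
Proof.
move=> a x y; rewrite /edot scaler_sumr -big_split; apply: eq_bigr => i _ /=.
by rewrite !mxE mulrDr /GRing.scale/= mulrCA.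
Qed.

HB.instance Definition _ u :=
  GRing.isLinear.Build R 'rV[R]_n R^o *:%R (edot u) (edot_is_linear u).

(** Lagrange's identity: the defect in the squared inequality is half of the sum
    of the squares of the [2 x 2] minors of [u] and [v]. *)
Lemma Cauchy_Schwarz_edot u v : `|edot u v| <= enorm u * enorm v.
Proof.
rewrite -(@ler_pXn2r _ 2) ?nnegrE ?mulr_ge0 ?enorm_ge0//.
rewrite real_normK ?num_real// exprMn !sqr_enorm.
have : 0 <= \sum_(i < n) \sum_(j < n) (u 0 i * v 0 j - u 0 j * v 0 i) ^+ 2.
  by apply: sumr_ge0 => i _; apply: sumr_ge0 => j _; exact: sqr_ge0.
suff -> : \sum_(i < n) \sum_(j < n) (u 0 i * v 0 j - u 0 j * v 0 i) ^+ 2 =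
    edot u u * edot v v + edot v v * edot u u - 2 * edot u v ^+ 2 by nra.
rewrite expr2 /edot !big_distrlr/= mulr_sumr -sumrN -!big_split/=.
apply: eq_bigr => i _; rewrite mulr_sumr -sumrN -!big_split/=.
by apply: eq_bigr => j _; ring.
Qed.

Lemma gradient_affine (a : {linear 'rV[R]_n -> R^o}) (b : R) x :
  gradient (fun y => a y + b) x = \row_(i < n) a (delta_mx 0 i).
Proof.
apply/rowP => i; rewrite !mxE; apply/lim_near_cst => //.
near=> h.
have h0 : h != 0 by near: h; exact: nbhs_dnbhs_neq.
rewrite /= (linearP a) opprD addrACA subrr addr0 addrK.
by rewrite scalerA mulVf// scale1r.
Unshelve. all: by end_near. Qed.

(** By Cauchy-Schwarz, as the increments of an affine function are the scalar
    products of its constant gradient with the displacement. *)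
Lemma affine_function_lipschitz (f : 'rV[R]_n -> R) (D : R) :
    affine_function f -> (forall x, enorm (gradient f x) <= D) ->
  elipschitz_on setT f D.
Proof.
move=> [a [b /funext ->]] gradD x y _ _.
have -> : a x + b - (a y + b) = edot (\row_i a (delta_mx 0 i)) (x - y).
  rewrite opprD addrACA subrr addr0 -linearB/=.
  rewrite {1}(row_sum_delta (x - y)) linear_sum; apply: eq_bigr => i _ /=.
  by rewrite linearZ [RHS]mulrC !mxE.
rewrite (le_trans (Cauchy_Schwarz_edot _ _))// ler_wpM2r ?enorm_ge0//.
by rewrite -(gradient_affine a b 0).
Qed.

Lemma affine_functionD (f g : 'rV[R]_n -> R) :
  affine_function f -> affine_function g -> affine_function (f \+ g).
Proof.
move=> [a [b fE]] [c [d gE]]; exists (a \+ c), (b + d) => x /=.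
by rewrite fE gE addrACA.
Qed.

Lemma affine_functionN (f : 'rV[R]_n -> R) :
  affine_function f -> affine_function (\- f).
Proof.
move=> [a [b fE]]; exists (\- a), (- b) => x /=.
by rewrite fE opprD.
Qed.

(** The quadratic parts of [|x|^2] and [|x - v|^2] cancel.  This is what makes the
    values claimed for the transforms affine after the quadratic shift. *)
Lemma affine_quadratic_gap (k c : R) v :
  affine_function (fun x => k * enorm x ^+ 2 + (c - k * enorm (x - v) ^+ 2)).
Proof.
exists (edot ((2 * k) *: v)), (c - k * edot v v) => x /=.
rewrite [edot (_ *: _) x]edotC [edot x (_ *: _)]linearZ/= !sqr_enorm.
rewrite (linearB (edot (x - v)))/= (edotC (x - v) x) (edotC (x - v) v).
rewrite (linearB (edot x)) (linearB (edot v))/= (edotC v x) /GRing.scale/=.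
ring.
Qed.

Lemma affine_function_conv (f : 'rV[R]_n -> R) (t : {i01 R}) x y :
    affine_function f ->
  f (conv t (x : convex_lmodType 'rV[R]_n) y) = conv t (f x : R^o) (f y).
Proof.
move=> [a [b fE]]; rewrite convRE !fE.
rewrite [LHS](_ : _ = a (t%:num *: x + (1 - t%:num) *: y) + b)//.
by rewrite linearD !linearZ/= /GRing.scale/= /unstable.onem; ring.
Qed.

Lemma convex_hull_ind (E C : set 'rV[R]_n) :
  convex_set C -> E `<=` C -> convex_hull E `<=` C.
Proof. by move=> cC EC x; apply. Qed.

(** The function [p] is itself one of the convex minorants of [g]; conversely, for
    any convex minorant [h] the set where [h <= p] is convex and contains [E],
    hence contains its convex hull. *)
Lemma convex_envelope_touching (g p : 'rV[R]_n -> R) (E : set 'rV[R]_n) x :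
    affine_function p -> (forall y, p y <= g y) -> (forall y, E y -> p y = g y) ->
  convex_hull E x -> convex_envelope g x = p x.
Proof.
move=> affp pg pE Ex; apply/eqP; rewrite eq_le.
have p_in : [set h : 'rV[R]_n -> R |
    convex_function [set: 'rV[R]_n] h /\ forall y, h y <= g y] p.
  by split=> // t y z _ _; rewrite affine_function_conv.
have ubp : ubound [set h x | h in [set h : 'rV[R]_n -> R |
    convex_function [set: 'rV[R]_n] h /\ forall y, h y <= g y]] (p x).
  move=> _ [h [cvxh hg] <-].
  apply: (@convex_hull_ind E [set y | h y <= p y]) Ex => [y z t|y Ey] /=.
    rewrite !inE/= => hy hz.
    rewrite (le_trans (cvxh _ _ _ _ _)) ?inE// affine_function_conv//.
    by rewrite !convRE lerD//; apply: ler_wpM2l => //; rewrite subr_ge0 le1.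
  by rewrite pE.
apply/andP; split; first by apply: ge_sup => //; exists (p x), p.
by apply: ub_le_sup; [exists (p x)|exists p].
Qed.

End EuclideanGeometry.

Section DelaunayCell.
Context {R : realType} {n : nat}.
Implicit Types (x y c : 'rV[R]_n) (K S : set 'rV[R]_n).

(** A point of [K] that is not a vertex is neither in the open ball, which misses
    [K], nor on the sphere, which meets [K] only in vertices; this yields
    [sigma > 0]. *)
Lemma delaunay_outside K S c r y :
  delaunay_cell K S c r -> (K `\` S) y -> r < enorm (y - c).
Proof.
move=> [_ _ ballK -> _] [Ky /not_andP[//|/eqP nyr]].
rewrite lt_neqAle eq_sym nyr/= leNgt; apply/negP => yr.
by have : (eball c r `&` K) y by []; rewrite ballK.
Qed.

(** The affine function [p] of the proof touches the shifted data at the vertices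
    and lies below it elsewhere: on [K], from distance [r + sigma] on, the quadratic
    term beats the variation of [l], and off [K] the constant [M] is large enough. *)
Lemma lower_transform_delaunay_cell K S c r (f l : 'rV[R]_n -> R)
    (A0 D sigma lambda M : R) x :
    0 <= A0 -> 0 <= D -> 0 < sigma -> S !=set0 ->
    delaunay_cell K S c r ->
    (forall y, K y -> `|f y| <= A0) ->
    affine_function l -> elipschitz_on setT l D ->
    (forall y, S y -> l y = f y) ->
    (forall y, (K `\` S) y -> sigma <= enorm (y - c) - r) ->
    0 < lambda ->
    2 * A0 / (sigma * (2 * r + sigma)) + D / sigma <= lambda ->
    lambda * r ^+ 2 + D * r + A0 + D ^+ 2 / (4 * lambda) <= M ->
    convex_hull S x ->
  lower_transform lambda (extend_by K f M) x
    = lambda * r ^+ 2 - lambda * enorm (x - c) ^+ 2 + l x.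
Proof.
move=> A0_ge0 D_ge0 sigma_gt0 [s Ss] [r_gt0 SK _ SE _] f_bnd affl lipl lf gap.
move=> lambda_gt0 le_lambda le_M Sx.
have on_sphere y : S y -> enorm (y - c) = r by rewrite SE => -[].
(* Going from a vertex to [y] through the centre costs [D r] and then [D d]. *)
have l_le y : l y <= A0 + D * r + D * enorm (y - c).
  have := lipl s c I I; have := lipl y c I I.
  rewrite (on_sphere s Ss) !ler_norml (lf _ Ss).
  have /ler_normlP[_ fs] := f_bnd _ (SK _ Ss).
  by move=> /andP[_ +] /andP[+ _]; lra.
pose p y := lambda * enorm y ^+ 2 + (lambda * r ^+ 2
  - lambda * enorm (y - c) ^+ 2) + l y.
rewrite /lower_transform (@convex_envelope_touching _ _ _ p S) //.
- by rewrite /p; ring.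
- exact: affine_functionD (affine_quadratic_gap _ _ _) affl.
- move=> y; rewrite /p -addrA lerD2l /extend_by /patch.
  have d_ge0 := enorm_ge0 (y - c); have := l_le y.
  set d := enorm (y - c) in d_ge0 *; move=> ly.
  case: ifPn => [/set_mem Ky|_].
    have [Sy|nSy] := pselect (S y).
      by rewrite /d on_sphere// lf//; lra.
    have := gap _ (conj Ky nSy); rewrite -/d => gapy.
    have /ler_normlP[fy _] := f_bnd _ Ky.
    suff : 2 * A0 + D * (d + r) <= lambda * (d ^+ 2 - r ^+ 2) by lra.
    have dr_ge0 : 0 <= (d - r) * (d + r) by apply: mulr_ge0; lra.
    (* The first uses [d - r >= sigma] and [d + r >= 2 r + sigma], the second
       only [d - r >= sigma]. *)
    have bnd_values : 2 * A0 <=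
        2 * A0 / (sigma * (2 * r + sigma)) * ((d - r) * (d + r)).
      rewrite mulrAC ler_pdivlMr; last by apply: mulr_gt0 => //; lra.
      by apply: ler_wpM2l; [lra|apply: ler_pM; lra].
    have bnd_slope : D * (d + r) <= D / sigma * ((d - r) * (d + r)).
      rewrite mulrAC ler_pdivlMr// -mulrA; apply: ler_wpM2l => //.
      by rewrite mulrC; apply: ler_wpM2r; lra.
    have := ler_wpM2r dr_ge0 le_lambda; rewrite subr_sqr mulrDl; lra.
  (* Completing the square in [d]. *)
  suff : D * d - lambda * d ^+ 2 <= D ^+ 2 / (4 * lambda) by lra.
  rewrite ler_pdivlMr ?mulr_gt0//.
  by have := sqr_ge0 (D - 2 * lambda * d); lra.
- move=> y Sy; rewrite /p /extend_by patchT ?inE; last exact: SK.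
  by rewrite on_sphere// lf//; ring.
Qed.

End DelaunayCell.

Lemma upper_transformE (R : realType) (n : nat) (lambda M : R)
    (K : set 'rV[R]_n) (f : 'rV[R]_n -> R) x :
  upper_transform lambda (extend_by K f (- M)) x
    = - lower_transform lambda (extend_by K (\- f) M) x.
Proof.
rewrite /upper_transform /lower_transform opprB; congr (_ - convex_envelope _ _).
apply/funext => y; congr (_ + _); rewrite /extend_by /patch.
by case: ifP => _; rewrite ?opprK.
Qed.

Theorem theorem4p5 (R : realType) (n : nat)
    (K S : set 'rV[R]_n) (fK : 'rV[R]_n -> R) (L A0 : R)
    (xs : 'rV[R]_n) (rs : R) (ells : 'rV[R]_n -> R) (Cs sigmas : R)
    (finK : finite_set K)
    (dimK : has_dim (convex_hull K) n)
    (L_gt0 : 0 < L)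
    (A0_gt0 : 0 < A0)
    (fK_lip : elipschitz_on K fK L)
    (fK_bnd : forall x, K x -> `|fK x| <= A0)
    (cellS : regular_delaunay_cell K S xs rs)
    (KDS : K `\` S !=set0)
    (ells_affine : affine_function ells)
    (ells_fK : forall x, S x -> ells x = fK x)
    (Cs_gt0 : 0 < Cs)
    (grad_ells : forall x, enorm (gradient ells x) <= Cs * L)
    (sigmasE : is_min [set enorm (x - xs) - rs | x in K `\` S] sigmas) :
  0 < sigmas /\
  forall lambda M : R,
    2 * A0 / (sigmas * (2 * rs + sigmas)) + Cs * L / sigmas < lambda ->
    lambda * rs ^+ 2 + Cs * L * rs + A0
      + Cs ^+ 2 * L ^+ 2 / (4 * lambda) < M ->
    forall x, convex_hull S x ->
      [/\ upper_transform lambda (extend_by K fK (- M)) x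
            = lambda * enorm (x - xs) ^+ 2 - lambda * rs ^+ 2 + ells x,
          lower_transform lambda (extend_by K fK M) x
            = lambda * rs ^+ 2 - lambda * enorm (x - xs) ^+ 2 + ells x,
          average_approx K fK lambda M x
            = (upper_transform lambda (extend_by K fK (- M)) x
               + lower_transform lambda (extend_by K fK M) x) / 2
        & average_approx K fK lambda M x = ells x].
Proof.
have [cell cardS] := cellS; have [rs_gt0 _ _ _ _] := cell.
have S0 : S !=set0.
  apply/set0P/negP => /eqP S0; move: cardS; rewrite S0 card_eq_sym card_eq0.
  by move=> /eqP I0; have : `I_n.+1 0%N by []; rewrite I0.
have [[y KSy <-] sigmas_min] := sigmasE.
set sigma := enorm (y - xs) - rs.
have sigma_gt0 : 0 < sigma by rewrite subr_gt0 (delaunay_outside cell).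
split=> //.
have gap z : (K `\` S) z -> sigma <= enorm (z - xs) - rs.
  by move=> KSz; apply: sigmas_min; exists z.
have D_gt0 : 0 < Cs * L by rewrite mulr_gt0.
have lip := affine_function_lipschitz ells_affine grad_ells.
move=> lambda M lt_lambda lt_M x Sx.
have lambda_gt0 : 0 < lambda.
  rewrite (le_lt_trans _ lt_lambda)// addr_ge0// divr_ge0 ?mulr_ge0 ?ltW//.
  by rewrite addr_gt0 ?mulr_gt0.
rewrite -exprMn in lt_M.
have lowerE : lower_transform lambda (extend_by K fK M) x
    = lambda * rs ^+ 2 - lambda * enorm (x - xs) ^+ 2 + ells x.
  by apply: (lower_transform_delaunay_cell (A0 := A0) (D := Cs * L) (S := S)
    (sigma := sigma)) => //; exact: ltW.
have upperE : upper_transform lambda (extend_by K fK (- M)) x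
    = lambda * enorm (x - xs) ^+ 2 - lambda * rs ^+ 2 + ells x.
  rewrite upper_transformE (@lower_transform_delaunay_cell _ _ K S xs rs (\- fK)
    (\- ells) A0 (Cs * L) sigma)//=; try exact: ltW.
  - by ring.
  - by move=> z Kz; rewrite normrN fK_bnd.
  - exact: affine_functionN.
  - by move=> u v _ _ /=; rewrite -opprD normrN lip.
  - by move=> z Sz; rewrite ells_fK.
by split => //; rewrite /average_approx upperE lowerE; field.
Qed.
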